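(* Let $F=G+H$ be as in the context, where each $h_j:\mathbb{R}^n\to\mathbb{R}$ is continuously differentiable, each $g_j:\mathbb{R}^n\to\mathbb{R}\cup\{+\infty\}$ is proper, convex and lower semicontinuous, and $\mathrm{dom}(G)$ is convex and compact. Assume in addition that, for every $j\in\mathcal{J}$, $\nabla h_j$ is Lipschitz continuous with constant $L_j>0$, and let $L=\max_{j\in\mathcal{J}}L_j$. Let $(x^k)_{k\in\mathbb{N}}$ be an infinite sequence generated by the generalized conditional gradient method with the adaptive step size (so that $\theta(x^k)<0$ for all $k$). Then every limit point of $(x^k)_{k\in\mathbb{N}}$ is a Pareto critical point of the problem $\min_{x\in\mathbb{R}^n}F(x)$.
   Context: $\mathcal{J}=\{1,\dots,m\}$, $\mathbb{N}=\{0,1,2,\dots\}$, $\|\cdot\|$ is the Euclidean norm. $F=(f_1,\dots,f_m)$, $f_j=g_j+h_j$, $G=(g_1,\dots,g_m)$, $H=(h_1,\dots,h_m)$, $\mathrm{dom}(G)=\{x\in\mathbb{R}^n: g_j(x)<+\infty\text{ for all }j\in\mathcal{J}\}$. A point $\bar x\in\mathrm{dom}(G)$ is Pareto critical if $\max_{j\in\mathcal{J}}f_j'(\bar x;d)\ge0$ for all $d\in\mathbb{R}^n$, where $f_j'(x;d)=\lim_{\alpha\to0^+}(f_j(x+\alpha d)-f_j(x))/\alpha$ (in the extended reals). For $x\in\mathrm{dom}(G)$, $\theta(x):=\min_{u\in\mathbb{R}^n}\max_{j\in\mathcal{J}}\big(g_j(u)-g_j(x)+\langle\nabla h_j(x),u-x\rangle\big)\le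 0$, and $p(x)\in\mathrm{dom}(G)$ denotes a point $u$ attaining this minimum. Generalized conditional gradient method: choose $x^0\in\mathrm{dom}(G)$; for $k=0,1,\dots$ compute a minimizer $p(x^k)$ and the value $\theta(x^k)$; stop if $\theta(x^k)=0$; otherwise compute a step size $\lambda_k\in(0,1]$ and set $x^{k+1}:=x^k+\lambda_k(p(x^k)-x^k)$. Adaptive step size: $\lambda_k:=\min\Big\{1,\dfrac{|\theta(x^k)|}{L\|p(x^k)-x^k\|^2}\Big\}$. *)

(* Defs.v *)
From HB Require Import structures.
From mathcomp Require Import all_boot all_order all_algebra.
From mathcomp Require Import all_classical all_reals all_analysis.
Set Implicit Arguments.
Unset Strict Implicit.
Unset Printing Implicit Defensive.
Import Order.TTheory GRing.Theory Num.Theory.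
Import numFieldNormedType.Exports.
Local Open Scope classical_set_scope.
Local Open Scope ring_scope.

Definition dotp (R : realType) (n : nat) (u v : 'rV[R]_n) : R :=
  \sum_(i < n) u 0 i * v 0 i.

(* The library norm on 'rV[R]_n is the sup norm; it induces the same topology,
   but the Lipschitz constants and the step size refer to the Euclidean one. *)
Definition enorm (R : realType) (n : nat) (u : 'rV[R]_n) : R :=
  Num.sqrt (dotp u u).

Definition grad (R : realType) (n : nat) (h : 'rV[R]_n -> R) (x : 'rV[R]_n) :
    'rV[R]_n :=
  \row_(i < n) 'D_(delta_mx 0 i) h x.

Definition continuously_differentiable (R : realType) (n : nat)
    (h : 'rV[R]_n -> R) : Prop :=
  (forall x, differentiable h x) /\ continuous (grad h).

Definition lipschitz_grad (R : realType) (n : nat) (l : R)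
    (h : 'rV[R]_n -> R) : Prop :=
  forall x y, enorm (grad h x - grad h y) <= l * enorm (x - y).

Definition proper_fun (R : realType) (n : nat) (g : 'rV[R]_n -> \bar R) : Prop :=
  (forall x, (-oo < g x)%E) /\ (exists x, (g x < +oo)%E).

(* At t = 0 and t = 1 the inequality is trivial, because 0 * +oo = 0. *)
Definition convex_efun (R : realType) (n : nat) (g : 'rV[R]_n -> \bar R) : Prop :=
  forall (x y : 'rV[R]_n) (t : R), 0 <= t <= 1 ->
    (g (t *: x + (1 - t) *: y)%R <= t%:E * g x + (1 - t)%:E * g y)%E.

Definition dom (R : realType) (n m : nat) (g : 'I_m -> 'rV[R]_n -> \bar R) :
    set 'rV[R]_n :=
  [set x | forall j, (g j x < +oo)%E].

(* Only meant for 0 < m: the default -oo is returned when m = 0. *)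
Definition emax (R : realType) (m : nat) (v : 'I_m -> \bar R) : \bar R :=
  \big[maxe/-oo%E]_(j < m) v j.

Definition objective (R : realType) (n m : nat)
    (g : 'I_m -> 'rV[R]_n -> \bar R) (h : 'I_m -> 'rV[R]_n -> R)
    (j : 'I_m) (x : 'rV[R]_n) : \bar R :=
  (g j x + (h j x)%:E)%E.

(* Limit in \bar R. It exists when f is the sum of a proper convex function and
   of a differentiable one and f x is finite: the difference quotient of the
   convex part is monotone in a, and that of the other part has a finite limit. *)
Definition dirderiv (R : realType) (n : nat) (f : 'rV[R]_n -> \bar R)
    (x d : 'rV[R]_n) : \bar R :=
  lim (((a^-1)%:E * (f (x + a *: d)%R - f x))%E @[a --> (0 : R)^'+]).

Definition pareto_critical (R : realType) (n m : nat)
    (g : 'I_m -> 'rV[R]_n -> \bar R) (h : 'I_m -> 'rV[R]_n -> R)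
    (x : 'rV[R]_n) : Prop :=
  dom g x /\
  forall d : 'rV[R]_n, (0 <= emax (fun j => dirderiv (objective g h j) x d))%E.

Definition subproblem (R : realType) (n m : nat)
    (g : 'I_m -> 'rV[R]_n -> \bar R) (h : 'I_m -> 'rV[R]_n -> R)
    (x u : 'rV[R]_n) : \bar R :=
  emax (fun j => g j u - g j x + (dotp (grad (h j) x) (u - x)%R)%:E)%E.

Definition theta (R : realType) (n m : nat)
    (g : 'I_m -> 'rV[R]_n -> \bar R) (h : 'I_m -> 'rV[R]_n -> R)
    (x : 'rV[R]_n) : \bar R :=
  ereal_inf (range (subproblem g h x)).

(* For x in dom g such a u is in dom g, since subproblem g h x x = 0. *)
Definition is_minimizer (R : realType) (n m : nat)
    (g : 'I_m -> 'rV[R]_n -> \bar R) (h : 'I_m -> 'rV[R]_n -> R)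
    (x u : 'rV[R]_n) : Prop :=
  subproblem g h x u = theta g h x.

(* An infinite run: the stopping test theta = 0 never succeeds. *)
Definition gen_cond_gradient (R : realType) (n m : nat)
    (g : 'I_m -> 'rV[R]_n -> \bar R) (h : 'I_m -> 'rV[R]_n -> R)
    (x p : nat -> 'rV[R]_n) (lam : nat -> R) : Prop :=
  dom g (x 0%N) /\
  forall k : nat,
    [/\ is_minimizer g h (x k) (p k),
        (theta g h (x k) < 0)%E,
        0 < lam k <= 1 &
        x k.+1 = x k + lam k *: (p k - x k)].

Definition adaptive_step (R : realType) (n m : nat)
    (g : 'I_m -> 'rV[R]_n -> \bar R) (h : 'I_m -> 'rV[R]_n -> R) (L : R)
    (x p : 'rV[R]_n) : R :=
  Num.min 1 (`|fine (theta g h x)| / (L * enorm (p - x) ^+ 2)).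

(* Main.v *)
Require Import Defs.
From HB Require Import structures.
From mathcomp Require Import all_boot all_order all_algebra.
From mathcomp Require Import all_classical all_reals all_analysis.
From mathcomp Require Import ring lra.
Import Order.TTheory GRing.Theory Num.Theory.
Import numFieldNormedType.Exports.
Local Open Scope classical_set_scope.
Local Open Scope ring_scope.

(** Suppose that a limit point xbar of the iterates is not Pareto critical.
    Some direction then decreases every objective to first order, so a short
    move along it makes the maximum in the subproblem at xbar negative:
    theta xbar < 0 ([theta_ge0_critical]).  The point u that witnesses this
    also works near xbar: only the terms - g_j y and the gradients of h_j
    depend on the base point y, the first are upper semicontinuous because g_j
    is lower semicontinuous, and the second are continuous.  Hence
    theta <= - e on a neighbourhood of xbar in the domain, for some e > 0
    ([near_theta_le]).

    On the other hand, convexity of g_j and the quadratic upper bound for a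
    function with Lipschitz gradient ([lipschitz_grad_upper_bound]) show that
    a step of length lam changes each objective by at most
    lam * theta + L / 2 * lam ^ 2 * |p - x| ^ 2.  The adaptive step size keeps
    lam * L * |p - x| ^ 2 below |theta|, so the objective drops by at least
    lam * |theta| / 2 ([adaptive_decrease]).  As the domain is bounded, this
    drop exceeds a fixed delta > 0 as soon as theta <= - e
    ([adaptive_decrement_ge]).

    So each of the infinitely many visits to that neighbourhood of xbar makes
    an objective fall by delta.  But the values of that objective along the run
    are nonincreasing, and bounded below since they are bounded below near
    xbar; they converge, and their consecutive differences tend to 0. *)

(** * The Euclidean inner product and functions with Lipschitz gradient *)

Section Euclidean.
Context {R : realType} {n : nat}.
Implicit Types (u v w x y d : 'rV[R]_n) (h : 'rV[R]_n -> R) (a l : R).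

Lemma dotpDl u v w : dotp (u + v) w = dotp u w + dotp v w.
Proof. by rewrite -big_split; apply: eq_bigr => i _; rewrite mxE mulrDl. Qed.

Lemma dotpZl a u v : dotp (a *: u) v = a * dotp u v.
Proof. by rewrite mulr_sumr; apply: eq_bigr => i _; rewrite mxE mulrA. Qed.

Lemma dotpC u v : dotp u v = dotp v u.
Proof. by apply: eq_bigr => i _; rewrite mulrC. Qed.

Lemma dotpDr u v w : dotp u (v + w) = dotp u v + dotp u w.
Proof. by rewrite dotpC dotpDl !(dotpC u). Qed.

Lemma dotpZr a u v : dotp u (a *: v) = a * dotp u v.
Proof. by rewrite dotpC dotpZl dotpC. Qed.

Lemma dotpBl u v w : dotp (u - v) w = dotp u w - dotp v w.
Proof. by rewrite -scaleN1r dotpDl dotpZl mulN1r. Qed.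

Lemma dotp_ge0 u : 0 <= dotp u u.
Proof. by apply: sumr_ge0 => i _; rewrite -expr2 sqr_ge0. Qed.

Lemma enorm_ge0 u : 0 <= enorm u.
Proof. exact: sqrtr_ge0. Qed.

Lemma sqr_enorm u : enorm u ^+ 2 = dotp u u.
Proof. by rewrite sqr_sqrtr// dotp_ge0. Qed.

Lemma enormZ a u : enorm (a *: u) = `|a| * enorm u.
Proof.
by rewrite /enorm dotpZl dotpZr mulrA -expr2 sqrtrM ?sqr_ge0// sqrtr_sqr.
Qed.

Lemma enorm_eq0 {u} : enorm u = 0 -> u = 0.
Proof.
move=> u0; have /eqP : dotp u u = 0 by rewrite -sqr_enorm u0 expr0n.
rewrite psumr_eq0; last by move=> i _; rewrite -expr2 sqr_ge0.
move/allP => u_0; apply/rowP => i; rewrite mxE; apply/eqP.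
by rewrite -sqrf_eq0 expr2; apply: (u_0 i); rewrite mem_index_enum.
Qed.

(** Cauchy-Schwarz: expand the square of |v| u - |u| v, which is nonnegative,
    and divide by 2 |u| |v|. *)
Lemma dotp_le_enorm u v : dotp u v <= enorm u * enorm v.
Proof.
have [u0|u0] := eqVneq (enorm u) 0.
  by rewrite (enorm_eq0 u0) -(scale0r v) dotpZl enormZ normr0 !mul0r.
have [v0|v0] := eqVneq (enorm v) 0.
  by rewrite (enorm_eq0 v0) -(scale0r u) dotpZr enormZ normr0 !mul0r mulr0.
have p0 : 0 < enorm u * enorm v by rewrite mulr_gt0// lt0r enorm_ge0 ?u0 ?v0.
have := dotp_ge0 (enorm v *: u + (- enorm u) *: v).
rewrite !(dotpDl, dotpDr, dotpZl, dotpZr) (dotpC v u) -!sqr_enorm => h.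
rewrite -subr_ge0 -(pmulr_rge0 _ p0); nra.
Qed.

Lemma derive_grad {h x} d : differentiable h x -> 'D_d h x = dotp (grad h x) d.
Proof.
move=> dh; rewrite deriveE// [in LHS](row_sum_delta d) linear_sum.
by apply: eq_bigr => i _; rewrite linearZ /= mxE deriveE// mulrC.
Qed.

(** Difference quotients of h along d at x + t d are those of the one-variable
    function s |-> h (x + s d) at t. *)
Lemma is_derive_line {h} x d (t : R) : differentiable h (x + t *: d) ->
  is_derive t 1 (fun s : R => h (x + s *: d)) (dotp (grad h (x + t *: d)) d).
Proof.
move=> dh; rewrite -derive_grad//.
have e : (fun s => s^-1 *: (((fun s : R => h (x + s *: d)) \o shift t) (s *: 1) -
      h (x + t *: d))) =
    (fun s => s^-1 *: ((h \o shift (x + t *: d)) (s *: d) - h (x + t *: d))).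
  apply/funext => s /=; congr (_ *: (h _ - _)).
  by rewrite -[s *: 1]/(s * 1) mulr1 scalerDl addrCA.
have := @diff_derivable _ _ _ h (x + t *: d) d dh.
rewrite /derivable /= => cv.
by split; [rewrite /derivable | rewrite /derive]; rewrite e.
Qed.

(** The defect q t = h (x + t d) - t <grad h x, d> - t ^ 2 l |d| ^ 2 / 2 has
    derivative <grad h (x + t d) - grad h x, d> - t l |d| ^ 2, which is
    nonpositive for t >= 0 by Cauchy-Schwarz and the Lipschitz condition;
    compare q 1 with q 0. *)
Lemma lipschitz_grad_upper_bound {l h} x d :
    0 <= l -> (forall y, differentiable h y) ->
    lipschitz_grad l h ->
  h (x + d) <= h x + dotp (grad h x) d + l / 2 * enorm d ^+ 2.
Proof.
move=> l0 dh hl.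
pose q (t : R) := h (x + t *: d) - t * dotp (grad h x) d -
  t ^+ 2 * (l / 2 * enorm d ^+ 2).
have dq (t : R) : is_derive t 1 q (dotp (grad h (x + t *: d)) d - dotp (grad h x) d
    - t * (l * enorm d ^+ 2)).
  have := is_derive_line x d t (dh _) => dht.
  rewrite /q; apply: is_derive_eq.
  by rewrite /GRing.scale /=; field.
have q1 : q 1 <= q 0.
  apply: (@ler0_derive1_nincr _ q 0 1) => //.
  - move=> t; rewrite in_itv /= => /andP[t0 t1]; rewrite derive1E.
    rewrite (@derive_val _ _ _ _ _ _ _ (dq t)) -dotpBl.
    rewrite subr_le0 (le_trans (dotp_le_enorm _ _))//.
    rewrite expr2 !mulrA ler_wpM2r ?enorm_ge0//.
    rewrite (le_trans (hl _ _))// addrAC subrr add0r enormZ gtr0_norm//.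
    by rewrite mulrCA mulrA.
  - apply: continuous_subspaceT => t.
    exact/differentiable_continuous/derivable1_diffP.
move: q1; rewrite /q scale0r addr0 scale1r mul0r expr0n /= mul0r !subr0.
rewrite expr1n !mul1r; lra.
Qed.

End Euclidean.

(** * Real-valued form of the subproblem, and the adaptive step *)

(** The j-th component of the subproblem as a real number; it agrees with the
    extended real one when x and u lie in the domain. *)
Definition gap {R : realType} {n m : nat} (g : 'I_m -> 'rV[R]_n -> \bar R)
    (h : 'I_m -> 'rV[R]_n -> R) (j : 'I_m) (x u : 'rV[R]_n) : R :=
  fine (g j u) - fine (g j x) + dotp (grad (h j) x) (u - x).

Section Composite.
Context {R : realType} {n m : nat}.
Context {g : 'I_m -> 'rV[R]_n -> \bar R} {h : 'I_m -> 'rV[R]_n -> R}.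
Context (g_proper : forall j, proper_fun (g j)).
Implicit Types (x y u p d : 'rV[R]_n) (j : 'I_m) (t eps lam : R).

Lemma dom_fin_num j {x} : dom g x -> g j x \is a fin_num.
Proof. by move=> /(_ j) gx; rewrite fin_real// (g_proper j).1. Qed.

Lemma fine_domK j {x} : dom g x -> (fine (g j x))%:E = g j x.
Proof. by move=> gx; rewrite fineK ?dom_fin_num. Qed.

Lemma subproblem_gtNy {x} u : (0 < m)%N -> dom g x -> (-oo < subproblem g h x u)%E.
Proof.
move=> m0 gx; pose j := Ordinal m0.
apply: lt_le_trans (le_bigmax _ _ j).
rewrite -(fine_domK j gx); have := (g_proper j).1 u; case: (g j u) => [r| |] //= _.
by rewrite -!EFinD ltNyr.
Qed.

Lemma subproblem_leP {x u} t : dom g x -> dom g u ->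
  (subproblem g h x u <= t%:E)%E <-> (forall j, gap g h j x u <= t).
Proof.
move=> gx gu; split.
  move=> /bigmax_leP[_ le_t] j; have := le_t j isT.
  by rewrite -(fine_domK _ gx) -(fine_domK _ gu) -EFinB -EFinD lee_fin.
move=> le_t; apply/bigmax_leP; split=> [|j _]; first exact: leNye.
by rewrite -(fine_domK _ gx) -(fine_domK _ gu) -EFinB -EFinD lee_fin; exact: le_t.
Qed.

(** If g_j u were +oo for some j, so would be the maximum, whose j-th term
    subtracts only a finite number. *)
Lemma subproblem_dom {x u} : dom g x -> (subproblem g h x u < +oo)%E -> dom g u.
Proof.
move=> gx /bigmax_ltP[_ lt0] j; have := lt0 j isT.
by rewrite -(fine_domK _ gx); have := (g_proper j).1 u; case: (g j u).
Qed.

(** Some value of the subproblem is below 0, since their infimum is.  This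
    serves at limit points, where the method supplies no minimizer. *)
Lemma theta_lt0_witness {x} : (0 < m)%N -> dom g x -> (theta g h x < 0)%E ->
  exists u t, [/\ dom g u, t < 0 & forall j, gap g h j x u <= t].
Proof.
move=> m0 gx /ereal_inf_lt[_ [u _ <-] su].
have gu : dom g u by apply: (subproblem_dom gx); rewrite (lt_trans su)// ltry.
have := subproblem_gtNy u m0 gx; case E : (subproblem g h x u) su => [s| |]//.
rewrite lte_fin => s0 _; exists u, s; split=> //.
by apply/subproblem_leP => //; rewrite E.
Qed.

(** Links the run to real numbers: theta is finite at x, so that the fine part
    occurring in the step size is its true value. *)
Lemma minimizer_spec {x p} : (0 < m)%N -> dom g x -> (theta g h x < 0)%E ->
    is_minimizer g h x p ->
  [/\ dom g p, fine (theta g h x) < 0 &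
      forall j, gap g h j x p <= fine (theta g h x)].
Proof.
move=> m0 gx th0 xp.
have gp : dom g p.
  by apply: (subproblem_dom gx); rewrite xp (lt_trans th0)// ltry.
have : (-oo < theta g h x)%E by rewrite -xp subproblem_gtNy.
case E : (theta g h x) th0 => [s| |]//; rewrite lte_fin => s0 _.
by split=> //; apply/subproblem_leP => //; rewrite xp E.
Qed.

Lemma convex_step {j x p lam} : convex_efun (g j) -> dom g x -> dom g p ->
    0 <= lam <= 1 ->
  (g j (x + lam *: (p - x))%R <=
   (fine (g j x) + lam * (fine (g j p) - fine (g j x)))%:E)%E.
Proof.
move=> gc gx gp lam01; have := gc p x lam lam01.
rewrite -(fine_domK _ gx) -(fine_domK _ gp) -!EFinM -EFinD.
have -> : lam *: p + (1 - lam) *: x = x + lam *: (p - x).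
  by rewrite scalerBl scale1r scalerBr addrCA.
move=> /le_trans; apply; rewrite lee_fin; lra.
Qed.

Lemma step_dom {x p lam} : (forall j, convex_efun (g j)) -> dom g x -> dom g p ->
  0 <= lam <= 1 -> dom g (x + lam *: (p - x)).
Proof.
move=> gc gx gp lam01 j.
by rewrite (le_lt_trans (convex_step (gc j) gx gp _))// ltry.
Qed.

(** Convexity of g_j and the quadratic bound on h_j give a change of at most
    lam * t + lam / 2 * (lam * L * |p - x| ^ 2), and the choice of lam makes
    the last parenthesis at most - t. *)
Lemma adaptive_decrease {Lj : 'I_m -> R} {x p} :
    let L := \big[Num.max/0]_(j < m) Lj j in
    let t := fine (theta g h x) in
    let lam := adaptive_step g h L x p in
    (forall j, 0 < Lj j) ->
    (forall j, lipschitz_grad (Lj j) (h j)) ->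
    (forall j y, differentiable (h j) y) ->
    (forall j, convex_efun (g j)) ->
    dom g x -> dom g p -> t < 0 -> (forall j, gap g h j x p <= t) -> 0 < lam <= 1 ->
  forall j, fine (g j (x + lam *: (p - x))) + h j (x + lam *: (p - x)) <=
    fine (g j x) + h j x + lam * t / 2.
Proof.
move=> L t lam Lj0 h_lip dh gc gx gp t0 gapt /andP[lam0 lam1] j.
have lam01 : 0 <= lam <= 1 by rewrite ltW.
have L_ge : Lj j <= L by exact: le_bigmax.
have gy : dom g (x + lam *: (p - x)) by exact: step_dom.
have := convex_step (gc j) gx gp lam01.
rewrite -(fine_domK _ gy) lee_fin /= => gD.
have := lipschitz_grad_upper_bound x (lam *: (p - x)) (ltW (Lj0 j)) (dh j) (h_lip j).
rewrite dotpZr enormZ (gtr0_norm lam0) exprMn => hD.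
have lamL : lam * (L * enorm (p - x) ^+ 2) <= - t.
  have L0 : 0 < L by exact: lt_le_trans L_ge.
  have [e0|e0] := eqVneq (enorm (p - x)) 0.
    by rewrite e0 expr0n !mulr0 oppr_ge0 ltW.
  have Le0 : 0 < L * enorm (p - x) ^+ 2.
    by rewrite mulr_gt0// exprn_gt0// lt0r e0 enorm_ge0.
  by rewrite -ler_pdivlMr// -(ltr0_norm t0) ge_min lexx orbT.
have lamLj : lam * (Lj j * enorm (p - x) ^+ 2) <= - t.
  by apply: le_trans lamL; rewrite ler_pM2l// ler_wpM2r// sqr_ge0.
have := gapt j; rewrite /gap => gapj.
have : lam * (fine (g j p) - fine (g j x) + dotp (grad (h j) x) (p - x))
   <= lam * t by rewrite ler_pM2l.
have : lam * (lam * (Lj j * enorm (p - x) ^+ 2)) <= lam * - t.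
  by rewrite ler_pM2l.
move: gD hD; lra.
Qed.

(** The step size is at least min (1, eps / (L D)), where D bounds the squared
    distance |p - x| ^ 2. *)
Lemma adaptive_decrement_ge {L D eps : R} {x p} :
    let t := fine (theta g h x) in
    let lam := adaptive_step g h L x p in
    0 < L -> 0 < D -> enorm (p - x) ^+ 2 <= D -> 0 < eps -> t <= - eps -> 0 < lam ->
  eps * Num.min 1 (eps / (L * D)) <= lam * - t.
Proof.
move=> t lam L0 D0 eD eps0 teps lam0.
have epst : eps <= - t by rewrite lerNr.
have t0 : 0 < - t by exact: lt_le_trans epst.
have min_lam : Num.min 1 (eps / (L * D)) <= lam.
  (* When p = x the quotient in the step size is a division by 0, with value 0. *)
  have e0 : 0 < L * enorm (p - x) ^+ 2.
    rewrite mulr_gt0// lt0r sqr_ge0 andbT; apply/eqP => e0.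
    by move: lam0; rewrite /lam /adaptive_step e0
      mulr0 invr0 mulr0 lt_min ltxx andbF.
  rewrite /lam /adaptive_step -/t ler0_norm; last by rewrite -oppr_ge0 ltW.
  rewrite le_min ge_min lexx /= ge_min; apply/orP; right.
  apply: ler_pM => //; [exact: ltW|by rewrite invr_ge0 ltW// mulr_gt0|].
  have LD0 : 0 < L * D by exact: mulr_gt0.
  by rewrite lef_pV2 ?posrE// ler_pM2l.
rewrite mulrC; apply: ler_pM => //; last exact: ltW.
by rewrite le_min ler01 ltW// divr_gt0// mulr_gt0.
Qed.

End Composite.

(** * Continuity of the inner product and boundedness *)

Section Topology.
Context {R : realType} {n : nat}.
Implicit Types (u v x y d : 'rV[R]_n).

Lemma cvg_dotp {T : Type} {F : set_system T} {FF : Filter F}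
    (a b : T -> 'rV[R]_n) u v :
  a s @[s --> F] --> u -> b s @[s --> F] --> v ->
  dotp (a s) (b s) @[s --> F] --> dotp u v.
Proof.
move=> au bv; apply: cvg_big => [|i _]; first exact: add_continuous.
apply: cvgM.
  exact: (continuous_cvg _ (@coord_continuous R 1 n 0 i u) au).
exact: (continuous_cvg _ (@coord_continuous R 1 n 0 i v) bv).
Qed.

(** A compact set is bounded for the sup norm, and the squared Euclidean norm is
    at most n times the squared sup norm. *)
Lemma compact_diameter (A : set 'rV[R]_n) : compact A ->
  exists2 D : R, 0 < D & forall x y, A x -> A y -> enorm (y - x) ^+ 2 <= D.
Proof.
move=> /compact_bounded[M [_ AM]].
have A_le : forall x, A x -> `|x| <= `|M| + 1.
  by apply: AM; rewrite (le_lt_trans (ler_norm _))// ltrDl.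
pose r := (`|M| + 1) + (`|M| + 1).
(* The summand 1 keeps the bound positive when n = 0 as well. *)
exists (1 + \sum_(i < n) r ^+ 2).
  by rewrite ltr_pwDl// sumr_ge0// => i _; rewrite sqr_ge0.
move=> x y Ax Ay; rewrite sqr_enorm ler_wpDl// ler_sum// => i _.
rewrite -expr2 -real_normK ?num_real// lerXn2r ?nnegrE//.
  by rewrite /r !addr_ge0.
apply: (@le_trans _ _ `|y - x|); last first.
  by rewrite (le_trans (ler_normB _ _))// lerD// A_le.
rewrite [leRHS]mx_normrE.
exact: (le_bigmax _ (fun ij => `|(y - x) ij.1 ij.2|) (0, i)).
Qed.

End Topology.

(** * Theta and Pareto criticality *)

Section Criticality.
Context {R : realType} {n m : nat}.
Context {g : 'I_m -> 'rV[R]_n -> \bar R} {h : 'I_m -> 'rV[R]_n -> R}.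
Context (m_gt0 : (0 < m)%N).
Context (g_proper : forall j, proper_fun (g j)).
Context (hC1 : forall j, continuously_differentiable (h j)).
Implicit Types (x y u d : 'rV[R]_n) (j : 'I_m).

Lemma near_lsc j x (e : R) : lower_semicontinuous (g j) -> dom g x -> 0 < e ->
  \forall y \near x, dom g y -> fine (g j x) - e < fine (g j y).
Proof.
move=> lsc gx e0.
have [|V xV Vlt] := lsc x (fine (g j x) - e).
  by rewrite -[ltRHS](fine_domK g_proper)// lte_fin ltrBlDr ltrDl.
apply: filterS xV => y /Vlt + gy.
by rewrite -[in X in X -> _](fine_domK g_proper j gy) lte_fin.
Qed.

(** Theta is upper semicontinuous at a point where it is negative: keep the
    witness u of theta x <= t < 0 and let the base point vary.  Of the slack
    - t / 2, one half absorbs the variation of g_j and the other that of the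
    linear term. *)
Lemma near_theta_le x : (forall j, lower_semicontinuous (g j)) -> dom g x ->
    (theta g h x < 0)%E ->
  exists2 e : R, 0 < e &
    \forall y \near x, dom g y -> (theta g h y <= (- e)%:E)%E.
Proof.
move=> lsc gx /(theta_lt0_witness g_proper m_gt0 gx)[u [t [gu t0 gapt]]].
have t4 : 0 < - t / 4 by rewrite divr_gt0// oppr_gt0.
exists (- t / 2); first by rewrite divr_gt0// oppr_gt0.
have near_gap : \forall y \near x, forall j, dom g y -> gap g h j y u <= t / 2.
  apply: (@filter_forall _ _
    (fun j y => dom g y -> gap g h j y u <= t / 2) (nbhs x) _) => j.
  have cdot : dotp (grad (h j) y) (u - y) @[y --> x] -->
      dotp (grad (h j) x) (u - x).
    apply: (@cvg_dotp _ _ _ (nbhs x)); first exact: (hC1 j).2.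
    by apply: cvgB; first exact: cvg_cst.
  have near_dot : \forall y \near x, dotp (grad (h j) y) (u - y) <
      dotp (grad (h j) x) (u - x) + - t / 4.
    by apply: (cvgr_lt _ cdot); rewrite ltrDl.
  apply: filterS2 near_dot (near_lsc j x _ (lsc j) gx t4) => y dlt glt gy.
  by have := glt gy; have := gapt j; rewrite /gap; lra.
apply: filterS near_gap => y gap_le gy.
apply: ge_ereal_inf; exists (subproblem g h y u).
  by exists u.
by apply/subproblem_leP => // j; rewrite (le_trans (gap_le j gy))//; lra.
Qed.

(** Along a direction of negative derivative, the difference quotient of f_j is
    below a negative c for small a > 0, while that of h_j is within - c of the
    derivative of h_j; so the linearization of h_j can replace h_j. *)
Lemma dirderiv_lt0 j x d : dom g x -> (dirderiv (objective g h j) x d < 0)%E ->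
  \forall a \near (0 : R)^'+,
    (g j (x + a *: d) < +oo)%E /\
    fine (g j (x + a *: d)) - fine (g j x) + a * dotp (grad (h j) x) d < 0.
Proof.
move=> gx; rewrite /dirderiv.
set q := (X in lim (X @ _)) => lt0.
(* A limit that does not exist has the default value 0, which is not negative. *)
have cq : cvg (q a @[a --> 0^'+]).
  by apply: contrapT => /dvgP q_dvg; move: lt0; rewrite q_dvg ltxx.
have [c c0 lc] : exists2 c : R, c < 0 & (lim (q a @[a --> 0^'+]) < c%:E)%E.
  case: (lim _) lt0 => [r| |]//.
    by rewrite lte_fin => r0; exists (r / 2); rewrite ?lte_fin; lra.
  by exists (-1); rewrite ?ltNyr//; lra.
have near_q : \forall a \near (0 : R)^'+, (q a < c%:E)%E.
  exact: (cq _ (open_ereal_lt_ereal lc)).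
have dh : a^-1 * (h j (x + a *: d) - h j x) @[a --> (0 : R)^'+] -->
    dotp (grad (h j) x) d.
  rewrite -derive_grad; last exact: (hC1 j).1.
  apply: cvg_dnbhs_at_right.
  rewrite (_ : (fun a => _) =
      (fun a => a^-1 *: ((h j \o shift x) (a *: d) - h j x))).
    exact: (@diff_derivable _ _ _ (h j) x d ((hC1 j).1 x)).
  by apply/funext => a /=; rewrite [x + _]addrC.
have near_h : \forall a \near (0 : R)^'+,
    dotp (grad (h j) x) d + c < a^-1 * (h j (x + a *: d) - h j x).
  by apply: (cvgr_gt _ dh); rewrite gtrDl.
apply: filterS3 near_q near_h (nbhs_right_gt 0) => a.
rewrite /q /objective -(fine_domK g_proper j gx).
have := (g_proper j).1 (x + a *: d).
case: (g j (x + a *: d)) => [r| |] //= _; last first.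
  by move=> + _ a0; rewrite mulry gtr0_sg ?invr_gt0// mul1e.
rewrite -!EFinD -EFinM lte_fin ltry => qa ha a0; split=> //.
have : a^-1 * (r - fine (g j x)) + dotp (grad (h j) x) d < 0 by lra.
rewrite -(pmulr_rlt0 _ a0) mulrDr mulrA divff ?gt_eqF//; lra.
Qed.

(** A direction along which all the derivatives are negative yields a point
    u = x + a d, with a small, where the subproblem has a negative value. *)
Lemma theta_ge0_critical x : dom g x -> (0 <= theta g h x)%E ->
  pareto_critical g h x.
Proof.
move=> gx th0; split=> // d; rewrite leNgt; apply/negP => /bigmax_ltP[_ lt0].
have near_desc : \forall a \near (0 : R)^'+, forall j,
    (g j (x + a *: d) < +oo)%E /\
    fine (g j (x + a *: d)) - fine (g j x) + a * dotp (grad (h j) x) d < 0.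
  apply: (@filter_forall _ _ (fun j a => (g j (x + a *: d) < +oo)%E /\
    fine (g j (x + a *: d)) - fine (g j x) + a * dotp (grad (h j) x) d < 0)) => j.
  exact: dirderiv_lt0 (lt0 j isT).
have [a alt0] := filter_ex near_desc.
have gu : dom g (x + a *: d) by move=> j; exact: (alt0 j).1.
move: th0; rewrite leNgt => /negP; apply.
apply: (@le_lt_trans _ _ (subproblem g h x (x + a *: d))).
  by apply: ereal_inf_lbound; exists (x + a *: d).
apply/bigmax_ltP; split=> [|j _]; first exact: ltNy0.
rewrite -(fine_domK g_proper j gu) -(fine_domK g_proper j gx) lte_fin.
have -> : x + a *: d - x = a *: d by rewrite addrC addKr.
by rewrite dotpZr; exact: (alt0 j).2.
Qed.

End Criticality.

(** * Convergence of the method *)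

Theorem theorem16 (R : realType) (n m : nat) (m_gt0 : (0 < m)%N)
  (g : 'I_m -> 'rV[R]_n -> \bar R) (h : 'I_m -> 'rV[R]_n -> R)
  (hC1 : forall j, continuously_differentiable (h j))
  (g_proper : forall j, proper_fun (g j))
  (g_convex : forall j, convex_efun (g j))
  (g_lsc : forall j, lower_semicontinuous (g j))
  (dom_convex : convex_set (dom g))
  (dom_compact : compact (dom g))
  (Lj : 'I_m -> R) (Lj_gt0 : forall j, 0 < Lj j)
  (h_lip : forall j, lipschitz_grad (Lj j) (h j))
  (x p : nat -> 'rV[R]_n) (lam : nat -> R)
  (x_gcg : gen_cond_gradient g h x p lam)
  (lam_adaptive : forall k,
     lam k = adaptive_step g h (\big[Num.max/0]_(j < m) Lj j) (x k) (p k)) :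
  forall xbar : 'rV[R]_n,
    cluster (x @ \oo) xbar -> pareto_critical g h xbar.
Proof.
move=> xbar cluster_xbar; have [gx0 step] := x_gcg.
have dh j y : differentiable (h j) y by exact: (hC1 j).1.
(* Every objective decreases along the run; any one of them gives the
   contradiction. *)
pose j0 := Ordinal m_gt0.
pose L := \big[Num.max/0]_(j < m) Lj j.
have L0 : 0 < L by apply: lt_le_trans (Lj_gt0 j0) _; exact: le_bigmax.
have lam01 k : 0 <= lam k <= 1.
  by have [_ _ /andP[lam0 lam1] _] := step k; rewrite ltW.
have gx k : dom g (x k).
  elim: k => // k gxk; have [xp th0 _ ->] := step k.
  have [gp _ _] := minimizer_spec g_proper m_gt0 gxk th0 xp.
  exact: step_dom.
have minp k : [/\ dom g (p k), fine (theta g h (x k)) < 0 &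
    forall j, gap g h j (x k) (p k) <= fine (theta g h (x k))].
  by have [xp th0 _ _] := step k; exact: minimizer_spec.
pose f k := fine (g j0 (x k)) + h j0 (x k).
have f_decr k : f k.+1 <= f k + lam k * fine (theta g h (x k)) / 2.
  have [_ _ lamk xk1] := step k; have [gp t0 gapt] := minp k.
  rewrite /f xk1 lam_adaptive; apply: adaptive_decrease => //.
  by rewrite -lam_adaptive.
have visits N (B : set 'rV[R]_n) : nbhs xbar B ->
    exists2 k, (N <= k)%N & B (x k).
  move=> xB; have [] := cluster_xbar [set x k | k in [set k | (N <= k)%N]] B _ xB.
    by exists N => // k Nk; exists k.
  by move=> _ [[k Nk <-] Bxk]; exists k.
have gxbar : dom g xbar.
  apply: (compact_closed (@norm_hausdorff _ _) dom_compact) => B.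
  move=> /(visits 0%N)[k _ Bk].
  by exists (x k).
have f_noninc : {homo f : i j / (i <= j)%N >-> j <= i}.
  apply/nonincreasing_seqP => k; rewrite (le_trans (f_decr k))// gerDl.
  have [_ t0 _] := minp k; have /andP[lamk _] := lam01 k.
  by rewrite -mulrA mulr_ge0_le0// pmulr_lle0// ltW.
(* The iterates visit a neighbourhood of xbar on which the objective is
   bounded below at arbitrarily late times, and f is nonincreasing in between. *)
have f_lb : has_lbound (range f).
  exists (fine (g j0 xbar) - 1 + (h j0 xbar - 1)) => _ [k _ <-].
  have near_h : \forall y \near xbar, h j0 xbar - 1 < h j0 y.
    apply: (cvgr_gt _ (differentiable_continuous (dh j0 xbar))).
    by rewrite gtrBl.
  have [i ki [gi hi]] := visits k _
    (filterI (near_lsc g_proper j0 xbar 1 (g_lsc j0) gxbar ltr01) near_h).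
  by rewrite (le_trans _ (f_noninc _ _ ki))// lerD ?ltW// gi.
have f_cvg := nonincreasing_is_cvgn f_noninc f_lb.
have df0 : f k - f k.+1 @[k --> \oo] --> 0.
  rewrite -(subrr (limn f)); apply: cvgB => //.
  by rewrite (cvg_shiftS f).
apply: (theta_ge0_critical g_proper hC1 xbar gxbar).
rewrite leNgt; apply/negP => th0.
have [e e0 near_e] := near_theta_le m_gt0 g_proper hC1 xbar g_lsc gxbar th0.
have [D D0 diam] := compact_diameter _ dom_compact.
pose delta := e * Num.min 1 (e / (L * D)) / 2.
have delta0 : 0 < delta.
  by rewrite divr_gt0// mulr_gt0// lt_min ltr01 divr_gt0// mulr_gt0.
have [N _ df_small] : \forall k \near \oo, f k - f k.+1 < delta.
  exact: (cvgr_lt _ df0).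
have [k Nk /(_ (gx k)) thk] := visits N _ near_e.
have [gp t0 _] := minp k; have [_ _ /andP[lam0 _] _] := step k.
have := df_small k Nk; apply/negP; rewrite -leNgt.
have te : fine (theta g h (x k)) <= - e.
  have [s st] : exists s, theta g h (x k) = s%:E.
    by case: (theta g h (x k)) t0 => [s| |]; rewrite ?ltxx//; exists s.
  by move: thk; rewrite st lee_fin.
have := @adaptive_decrement_ge _ _ _ g h L D e (x k) (p k) L0 D0
  (diam _ _ (gx k) gp) e0 te.
rewrite -lam_adaptive => /(_ lam0); have := f_decr k; rewrite /delta; lra.
Qed.
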